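(* Let $n\ge2$ and let $\chi=(P_1,\ldots,P_{n+1})$ be a degree $m$ vector field on $\mathbb{S}^n$. Suppose $\chi$ has the invariant great $(n-1)$-sphere $\{x_{n+1}=0\}\cap\mathbb{S}^n$. The following hold. (1) If $m=1$, then $P_{n+1}=0$. (2) If $m=2$, then $$P_{n+1}=\Big(1-\sum_{k=1}^{n+1}x_k^2\Big)\alpha+\sum_{j=1}^{n}A_{(n+1)j}x_j,$$ where $\alpha$ is a real number and $A_{(n+1)j}=c_1^jx_1+\cdots+c_{n+1}^jx_{n+1}$ with real constants $c_i^j$ ($1\le i\le n+1$, $1\le j\le n$) such that the constant $n\times n$ matrix $C=(c_i^j)_{1\le i,j\le n}$ is skew-symmetric.
   Context: $\mathbb{S}^n=\{x\in\mathbb{R}^{n+1} : \sum_i x_i^2=1\}$. A polynomial vector field $\chi=(P_1,\ldots,P_{n+1})$ in $\mathbb{R}^{n+1}$ is identified with the operator $\sum_i P_i\,\partial/\partial x_i$; its degree is $\max_i\deg P_i$. It is a vector field on $\mathbb{S}^n$ if $\chi(\sum_i x_i^2-1)=K(\sum_i x_i^2-1)$ for some real polynomial $K$. A subset of $\mathbb{R}^{n+1}$ is invariant for $\chi$ if it is a union of trajectories of $\chi$. *)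

(* Defs.v *)
(* MathComp / MathComp-Analysis, over an arbitrary [R : realType]. *)
From HB Require Import structures.
From mathcomp Require Import all_boot all_order all_algebra.
From mathcomp Require Import all_classical all_reals all_analysis.
(* The notations of multinomials and of MathComp-Analysis clash, so mpoly is
   imported without its notations; the ones needed are redeclared below. *)
From mathcomp Require Export -(notations) mpoly.

Set Implicit Arguments.
Unset Strict Implicit.
Unset Printing Implicit Defensive.

Import Order.TTheory GRing.Theory Num.Theory numFieldNormedType.Exports.
Local Open Scope classical_set_scope.
Local Open Scope ring_scope.

Notation "{ 'mpoly' R [ n ] }" := (mpoly n R) (format "{ 'mpoly'  R [ n ] }").
Notation "''X_' i" := (mpolyX _ (mnm1 i))
  (at level 8, i at level 2, format "''X_' i") : ring_scope.
Notation "c %:MP" := (mpolyC _ c) (format "c %:MP") : ring_scope.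
Notation "p .@[ v ]" := (meval v p) (format "p .@[ v ]") : ring_scope.

Definition vector_field (R : realType) (N : nat) : Type := 'I_N -> {mpoly R[N]}.

(* [mmeasure mdeg p] is the total degree of [p] plus one, and 0 for [p = 0];
   constants and the zero polynomial both count as degree 0 here. *)
Definition vf_degree (R : realType) (N : nat) (P : vector_field R N) : nat :=
  \max_(i < N) (mmeasure mdeg (P i)).-1.

Definition vf_apply (R : realType) (N : nat) (P : vector_field R N)
    (f : {mpoly R[N]}) : {mpoly R[N]} :=
  \sum_(i < N) P i * mderiv i f.

Definition sphere_poly (R : realType) (N : nat) : {mpoly R[N]} :=
  \sum_(i < N) 'X_i ^+ 2 - 1.

Definition unit_sphere (R : realType) (N : nat) : set 'rV[R]_N :=
  [set x : 'rV[R]_N | \sum_(i < N) x 0 i ^+ 2 = 1].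
Arguments unit_sphere : clear implicits.

Definition vf_on_sphere (R : realType) (N : nat) (P : vector_field R N) : Prop :=
  exists K : {mpoly R[N]},
    vf_apply P (sphere_poly R N) = K * sphere_poly R N.

Definition vf_eval (R : realType) (N : nat) (P : vector_field R N)
    (x : 'rV[R]_N) : 'rV[R]_N :=
  \row_(i < N) (P i).@[x 0].

(* [g] is total, but only its values on the open interval [J] matter. *)
Definition integral_curve (R : realType) (N : nat) (P : vector_field R N)
    (J : set R) (g : R -> 'rV[R]_N) : Prop :=
  [/\ open J, is_interval J, J !=set0 &
      forall t, J t -> is_derive t 1 g (vf_eval P (g t))].

Definition maximal_integral_curve (R : realType) (N : nat)
    (P : vector_field R N) (J : set R) (g : R -> 'rV[R]_N) : Prop :=
  integral_curve P J g /\
  forall (J' : set R) (g' : R -> 'rV[R]_N), integral_curve P J' g' ->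
    J `<=` J' -> (forall t, J t -> g' t = g t) -> J' = J.

Definition trajectory (R : realType) (N : nat) (P : vector_field R N)
    (T : set 'rV[R]_N) : Prop :=
  exists (J : set R) (g : R -> 'rV[R]_N),
    maximal_integral_curve P J g /\ T = g @` J.

Definition invariant_set (R : realType) (N : nat) (P : vector_field R N)
    (S : set 'rV[R]_N) : Prop :=
  exists F : set (set 'rV[R]_N),
    (forall T, F T -> trajectory P T) /\ S = \bigcup_(T in F) T.

(* The coordinates x_1, ..., x_{n+1} are indexed by ['I_n.+1]: x_{n+1} is
   [ord_max], and x_j for 1 <= j <= n is [fst_coord j] with [j : 'I_n]. *)
Definition fst_coord (n : nat) (j : 'I_n) : 'I_n.+1 := widen_ord (leqnSn n) j.

Definition last_great_sphere (R : realType) (n : nat) : set 'rV[R]_n.+1 :=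
  [set x : 'rV[R]_n.+1 | x 0 ord_max = 0] `&` unit_sphere R n.+1.
Arguments last_great_sphere : clear implicits.

(* Main.v *)
Require Import Defs.
From HB Require Import structures.
From mathcomp Require Import all_boot all_order all_algebra.
From mathcomp Require Import all_classical all_reals all_analysis.
From mathcomp Require Import ring lra.
Import Order.TTheory GRing.Theory Num.Theory numFieldNormedType.Exports.
Local Open Scope classical_set_scope.
Local Open Scope ring_scope.

(** Write Q for the last component P_{n+1}. Two facts about its zeros suffice.

    A point of the great sphere lies on a trajectory along which x_{n+1}
    vanishes identically; differentiating, Q vanishes there
    ([invariant_tangent]). On the other hand, evaluating the identity
    chi(|x|^2 - 1) = K (|x|^2 - 1) at a point of the unit sphere gives
    sum_i x_i P_i(x) = 0 ([sphere_orthogonal]), and at the poles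
    x = (0, ..., 0, +-1) this sum is +-Q(x). So Q vanishes on the equator
    and at both poles.

    The rest is interpolation of a polynomial of degree at most 2,
    Q = a + sum_i b_i x_i + sum_{i,j} q_ij x_i x_j. The points +-e_i force
    b_i = 0 and q_ii = -a for every i, poles included; the equatorial points
    (e_i + e_j) / sqrt 2 force q_ij + q_ji = 0 for distinct i, j <= n. What
    remains is Q = a (1 - |x|^2) + x_{n+1} L with L linear in x_1, ..., x_n
    ([quadratic_vanishing_equator_poles]). This is the required form with
    A_{(n+1)j} a multiple of x_{n+1}, so that the matrix C is even 0. If the
    degree is 1, the points +-e_i alone force Q = 0
    ([affine_vanishing_axes]). *)

(** Every nonconstant monomial is divisible by some variable, and dividing it
    out lowers the degree. Iterating this gives the coordinate expressions of
    polynomials of degree 1 and 2 without indexing by multi-exponents; note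
    that [mmeasure mdeg] is the degree plus one. *)
Lemma mpoly_split_const {R : comNzRingType} {N : nat} (k : nat) (p : {mpoly R[N]}) :
  (mmeasure mdeg p <= k.+1)%N ->
  exists (c : R) (r : 'I_N -> {mpoly R[N]}),
    (forall i, (mmeasure mdeg (r i) <= k)%N) /\
    p = c%:MP + \sum_(i < N) r i * 'X_i.
Proof.
move=> szp; rewrite (mpolyE p) big_seq.
elim/big_rec: _ => [|m q m_in [c [r [szr ->]]]].
  exists 0, (fun=> 0); split=> [i|]; first by rewrite mmeasure0.
  by rewrite mpolyC0 big1 ?addr0// => i _; rewrite mul0r.
have [m0|] := boolP [forall i, m i == 0%N].
  have -> : m = mnm0 by apply/mnmP=> i; rewrite mnm0E; apply/eqP/(forallP m0).
  exists (mcoeff mnm0 p + c), r; split=> //.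
  by rewrite mpolyCD -addrA mpolyX0 alg_mpolyC.
rewrite negb_forall => /existsP[i mi].
have Um : mpoly.lem (mnm1 i) m by rewrite lep1mP.
pose mono_i := mcoeff m p *: mpolyX R (mnm_sub m (mnm1 i)).
exists c, (fun j => r j + (if j == i then mono_i else 0)); split=> [j|].
  apply: leq_trans (msizeD_le _ _) _; rewrite geq_max szr/=.
  case: ifP => _; last by rewrite mmeasure0.
  apply: leq_trans (msizeZ_le _ _) _; rewrite msizeX.
  have := leq_trans (msize_mdeg_lt m_in) szp.
  by rewrite -{1}(submK Um) mdegD mdeg1 addn1 ltnS.
rewrite addrCA; congr (_ + _).
under [RHS]eq_bigr => j _ do rewrite mulrDl.
rewrite big_split/= addrC; congr (_ + _).
rewrite (bigD1 i)//= eqxx big1 ?addr0; last by move=> j /negPf ->; rewrite mul0r.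
by rewrite -scalerAl -mpolyXD submK.
Qed.

Lemma mpoly_deg1 {R : comNzRingType} {N : nat} (p : {mpoly R[N]}) :
  (mmeasure mdeg p <= 2)%N ->
  exists (a : R) (b : 'I_N -> R), p = a%:MP + \sum_(i < N) (b i)%:MP * 'X_i.
Proof.
move=> /mpoly_split_const[a [r [szr ->]]].
exists a, (fun i => mcoeff mnm0 (r i)); congr (_ + _).
by apply: eq_bigr => i _; rewrite {1}(msize1_polyC (szr i)).
Qed.

Lemma mpoly_deg2 {R : comNzRingType} {N : nat} (p : {mpoly R[N]}) :
  (mmeasure mdeg p <= 3)%N ->
  exists (a : R) (b : 'I_N -> R) (q : 'I_N -> 'I_N -> R),
    p = a%:MP + \sum_(i < N) (b i)%:MP * 'X_i
        + \sum_(i < N) \sum_(j < N) (q i j)%:MP * ('X_i * 'X_j).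
Proof.
move=> /mpoly_split_const[a [r [szr ->]]].
have /boolp.choice[b hb] : forall i, exists bq : R * ('I_N -> R),
    r i = bq.1%:MP + \sum_(j < N) (bq.2 j)%:MP * 'X_j.
  by move=> i; have [b [q ->]] := mpoly_deg1 _ (szr i); exists (b, q).
exists a, (fun i => (b i).1), (fun i => (b i).2).
rewrite -addrA -big_split/=; congr (_ + _); apply: eq_bigr => i _.
rewrite hb mulrDl mulr_suml; congr (_ + _); apply: eq_bigr => j _.
by rewrite -mulrA [_ * 'X_i]mulrC.
Qed.

(** The trajectory through [x] stays in [S], so its [i]-th coordinate is
    constantly 0 on an open interval; the derivative of that coordinate is the
    [i]-th component of the field at [x]. *)
Lemma invariant_tangent {R : realType} {N : nat} (P : vector_field R N)
    (S : set 'rV[R]_N) (i : 'I_N) (x : 'rV[R]_N) :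
  invariant_set P S -> (forall y, S y -> y 0 i = 0) -> S x -> (P i).@[x 0] = 0.
Proof.
move=> [F [trajF defS]] Si0; rewrite {1}defS => -[T FT Tx].
have [J [g [[[Jopen _ _ gder] _] defT]]] := trajF T FT.
move: Tx; rewrite defT => -[t Jt gtx].
have git0 s : J s -> g s 0 i = 0.
  by move=> Js; apply: Si0; rewrite defS; exists T => //; rewrite defT; exists s.
have [gt_derivable gtE] := gder t Jt.
have : 'D_1 g t 0 i = 0.
  rewrite derive_mx// mxE (near_eq_derive (g := cst 0)) ?derive_cst//.
  by near=> s; apply: git0; near: s; exact: open_nbhs_nbhs.
by rewrite gtE gtx mxE.
Unshelve. all: by end_near. Qed.

Lemma mderiv_sphere_poly (R : realType) (N : nat) (i : 'I_N) :
  mderiv i (sphere_poly R N) = 'X_i *+ 2.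
Proof.
have derivX j : mderiv i ('X_j : {mpoly R[N]}) = (j == i)%:R.
  rewrite mderivX mnm1E; case: eqVneq => [->|_]; last by rewrite scale0r.
  have -> : mnm_sub (mnm1 i) (mnm1 i) = mnm0.
    by apply/mnmP=> k; rewrite mnmBE subnn mnm0E.
  by rewrite mpolyX0 scale1r.
rewrite /sphere_poly mderivB mderivC subr0 (raddf_sum (mderiv i)) (bigD1 i)//=.
rewrite [X in _ + X]big1 => [|j /negPf ji]; rewrite expr2 mderivM derivX.
  by rewrite eqxx mul1r mulr1 addr0 mulr2n.
by rewrite ji mul0r mulr0 addr0.
Qed.

(** The right-hand side of chi(|x|^2 - 1) = K (|x|^2 - 1) vanishes on the
    sphere, and the left-hand side is twice the inner product of the field
    with the position vector. *)
Lemma sphere_orthogonal {R : realType} {N : nat} (P : vector_field R N)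
    (x : 'rV[R]_N) :
  vf_on_sphere P -> unit_sphere R N x -> \sum_(i < N) (P i).@[x 0] * x 0 i = 0.
Proof.
move=> [K /(congr1 (meval (x 0)))]; rewrite mevalM => + Sx.
have -> : (sphere_poly R N).@[x 0] = 0.
  rewrite /sphere_poly mevalB meval1 raddf_sum/= -[RHS](subrr 1) -{2}Sx.
  by congr (_ - _); apply: eq_bigr => i _; rewrite expr2 mevalM mevalXU.
rewrite mulr0 /vf_apply raddf_sum/= => E0.
suff : 2 * \sum_(i < N) (P i).@[x 0] * x 0 i = 0.
  by move/eqP; rewrite mulf_eq0 pnatr_eq0/= => /eqP.
rewrite -[RHS]E0 mulr_sumr; apply: eq_bigr => i _.
by rewrite mevalM mderiv_sphere_poly mevalMn mevalXU mulr_natl mulrnAr.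
Qed.

(** The interpolation nodes. Letting [i = j] and [t = 0] yields the axis
    points [s e_i] too, so the evaluation formulas below are stated without
    assuming [i != j] and serve both kinds of nodes. *)
Definition two_coord_point {R : realType} {N : nat} (i j : 'I_N) (s t : R) :
  'rV[R]_N := s *: delta_mx 0 i + t *: delta_mx 0 j.

Lemma sum_two_coord_point {R : realType} {N : nat} (i j : 'I_N) (s t : R)
    (f : 'I_N -> R) :
  \sum_(k < N) f k * two_coord_point i j s t 0 k = f i * s + f j * t.
Proof.
under eq_bigr do rewrite !mxE eqxx/= mulrDr.
rewrite big_split/= (bigD1 i)//= eqxx big1 ?addr0; last first.
  by move=> k /negPf ->; rewrite !mulr0.
rewrite (bigD1 j)//= eqxx big1 ?addr0 ?mulr1//.
by move=> k /negPf ->; rewrite !mulr0.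
Qed.

Lemma two_coord_pointE {R : realType} {N : nat} (i j : 'I_N) (s t : R) (k : 'I_N) :
  two_coord_point i j s t 0 k = s *+ (k == i) + t *+ (k == j).
Proof. by rewrite !mxE eqxx/= !mulr_natr. Qed.

Lemma unit_sphere_axis {R : realType} {N : nat} (i : 'I_N) (s : R) :
  s ^+ 2 = 1 -> unit_sphere R N (two_coord_point i i s 0).
Proof.
move=> s1; rewrite /unit_sphere/=; under eq_bigr do rewrite expr2.
by rewrite sum_two_coord_point two_coord_pointE eqxx mul0rn mulr0 !addr0 -expr2.
Qed.

Lemma unit_sphere_two_coord {R : realType} {N : nat} (i j : 'I_N) (s t : R) :
  i != j -> s ^+ 2 + t ^+ 2 = 1 -> unit_sphere R N (two_coord_point i j s t).
Proof.
move=> ij st1; rewrite /unit_sphere/=; under eq_bigr do rewrite expr2.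
rewrite sum_two_coord_point !two_coord_pointE !eqxx [j == i]eq_sym (negPf ij).
by rewrite !mulr0n !mulr1n addr0 add0r -!expr2.
Qed.

Lemma eval_linear {R : realType} {N : nat} (b : 'I_N -> R) (i j : 'I_N) (s t : R) :
  (\sum_(k < N) (b k)%:MP * 'X_k).@[two_coord_point i j s t 0] = b i * s + b j * t.
Proof.
rewrite raddf_sum/= -sum_two_coord_point; apply: eq_bigr => k _.
by rewrite mevalM mevalC mevalXU.
Qed.

Lemma eval_quadratic {R : realType} {N : nat} (q : 'I_N -> 'I_N -> R)
    (i j : 'I_N) (s t : R) :
  (\sum_(k < N) \sum_(l < N) (q k l)%:MP * ('X_k * 'X_l)).@[two_coord_point i j s t 0]
  = q i i * s ^+ 2 + (q i j + q j i) * (s * t) + q j j * t ^+ 2.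
Proof.
set x := two_coord_point i j s t 0.
transitivity (\sum_(k < N) (q k i * s + q k j * t) * x k).
  rewrite raddf_sum/=; apply: eq_bigr => k _.
  rewrite -sum_two_coord_point mulr_suml raddf_sum/=; apply: eq_bigr => l _.
  by rewrite !mevalM mevalC !mevalXU -/x mulrAC mulrA.
by rewrite sum_two_coord_point; ring.
Qed.

(** A quadratic form determines only the symmetric part of its coefficient
    matrix: averaging over the exchange of the two indices leaves the entries
    [q i j + q j i], hence the factor 2 to be cancelled. *)
Lemma quadratic_form_scalar {A : idomainType} {N : nat} (q : 'I_N -> 'I_N -> A)
    (c : A) (y : 'I_N -> A) :
  2%:R != 0 :> A ->
  (forall i j, q i j + q j i = c *+ 2 *+ (i == j)) ->
  \sum_(i < N) \sum_(j < N) q i j * (y i * y j) = c * \sum_(i < N) y i ^+ 2.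
Proof.
move=> two_neq0 symq; apply: (mulfI two_neq0).
set S := \sum_(i < N) _.
have {1}-> : 2 * S = S + \sum_(i < N) \sum_(j < N) q j i * (y i * y j).
  rewrite mulr_natl mulr2n; congr (_ + _); rewrite /S exchange_big/=.
  by apply: eq_bigr => i _; apply: eq_bigr => j _; rewrite [y j * _]mulrC.
rewrite -big_split/= !mulr_sumr; apply: eq_bigr => i _.
rewrite -big_split/= (bigD1 i)//= -mulrDl symq eqxx big1 ?addr0; last first.
  by move=> j ji; rewrite -mulrDl symq eq_sym (negPf ji) mul0r.
by rewrite mulr1n -expr2 mulr_natl mulrnAl.
Qed.

(** The values at [e_i] and [-e_i] are [a + b_i] and [a - b_i]. *)
Lemma affine_vanishing_axes {R : realType} {N : nat} (p : {mpoly R[N]}) :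
  (0 < N)%N -> (mmeasure mdeg p <= 2)%N ->
  (forall i s, s ^+ 2 = 1 -> p.@[two_coord_point i i s 0 0] = 0) -> p = 0.
Proof.
move=> N_gt0 /mpoly_deg1[a [b ->]] p0.
have ab i s : s ^+ 2 = 1 -> a + b i * s = 0.
  by move=> /(p0 i); rewrite mevalD mevalC eval_linear mulr0 addr0.
have one1 : (1 : R) ^+ 2 = 1 by rewrite expr1n.
have mone1 : (-1 : R) ^+ 2 = 1 by rewrite sqrrN expr1n.
have b0 i : b i = 0.
  by have := ab i 1 one1; have := ab i (-1) mone1; lra.
have a0 : a = 0.
  by have := ab (Ordinal N_gt0) 1 one1; rewrite b0 mul0r addr0.
rewrite a0 big1 ?addr0 ?mpolyC0// => i _.
by rewrite b0 mpolyC0 mul0r.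
Qed.

(** The axis points determine the linear and the diagonal coefficients, the
    bisectors of the equatorial axes the mixed ones; the products
    [x_j x_{n+1}] vanish at all these nodes and so remain free. *)
Lemma quadratic_vanishing_equator_poles {R : realType} {n : nat} (p : {mpoly R[n.+1]}) :
  (mmeasure mdeg p <= 3)%N ->
  (forall i s, s ^+ 2 = 1 -> p.@[two_coord_point i i s 0 0] = 0) ->
  (forall x, last_great_sphere R n x -> p.@[x 0] = 0) ->
  exists (a : R) (e : 'I_n -> R),
    p = (1 - \sum_(k < n.+1) 'X_k ^+ 2) * a%:MP
        + \sum_(j < n) (e j *: 'X_ord_max) * 'X_(fst_coord j).
Proof.
move=> /mpoly_deg2[a [b [q ->]]] axis0 equator0.
have abq i s : s ^+ 2 = 1 -> a + b i * s + q i i = 0.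
  move=> s1; have := axis0 i s s1.
  rewrite !mevalD mevalC eval_linear eval_quadratic s1.
  by rewrite !mulr0 expr0n/= mulr0 !addr0 mulr1.
have one1 : (1 : R) ^+ 2 = 1 by rewrite expr1n.
have mone1 : (-1 : R) ^+ 2 = 1 by rewrite sqrrN expr1n.
have b0 i : b i = 0 by have := abq i 1 one1; have := abq i (-1) mone1; lra.
have qii i : q i i = - a by have := abq i 1 one1; rewrite b0; lra.
have fst_neq_max (i : 'I_n) : fst_coord i != ord_max.
  by rewrite -val_eqE/= neq_ltn ltn_ord.
have qij (i j : 'I_n) : i != j ->
    q (fst_coord i) (fst_coord j) + q (fst_coord j) (fst_coord i) = 0.
  move=> ij; pose r : R := Num.sqrt 2^-1.
  have rr : r ^+ 2 = 2^-1 by rewrite sqr_sqrtr// invr_ge0.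
  have : last_great_sphere R n
      (two_coord_point (fst_coord i) (fst_coord j) r r).
    split=> /=; last first.
      by apply: unit_sphere_two_coord; [exact: ij | rewrite rr; lra].
    rewrite two_coord_pointE ![ord_max == _]eq_sym.
    by rewrite !(negPf (fst_neq_max _)) addr0.
  move=> /equator0; rewrite !mevalD mevalC eval_linear eval_quadratic.
  by rewrite !b0 !qii -expr2 rr; lra.
exists a, (fun j => q ord_max (fst_coord j) + q (fst_coord j) ord_max).
(* Separating the last variable in both indices isolates the form in
   x_1, ..., x_n, which is -a times the sum of their squares; together with
   q_{n+1,n+1} = -a it completes the square of the norm. *)
rewrite big1 ?addr0; last by move=> i _; rewrite b0 mpolyC0 mul0r.
rewrite big_ord_recr/=; under eq_bigr do rewrite big_ord_recr/=.
rewrite big_split/= [\sum_(j < n.+1) _]big_ord_recr/=.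
rewrite (quadratic_form_scalar
  (fun i j => (q (fst_coord i) (fst_coord j))%:MP) (- a%:MP)
  (fun i => 'X_(fst_coord i))); first last.
- move=> i j; have [<-|ij] := eqVneq i j.
    by rewrite qii mpolyCN.
  by rewrite -mpolyCD qij.
- by rewrite -mpolyC_nat mpolyC_eq0 pnatr_eq0.
rewrite [\sum_(k < n.+1) _]big_ord_recr/= qii.
set S := \sum_(i < n) _ ^+ 2.
have -> : \sum_(j < n)
      ((q ord_max (fst_coord j) + q (fst_coord j) ord_max) *: 'X_ord_max)
      * 'X_(fst_coord j) =
    \sum_(i < n) (q (fst_coord i) ord_max)%:MP * ('X_(fst_coord i) * 'X_ord_max)
    + \sum_(i < n) (q ord_max (fst_coord i))%:MP * ('X_ord_max * 'X_(fst_coord i)).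
  rewrite -big_split/=; apply: eq_bigr => i _.
  by rewrite -mul_mpolyC mpolyCD; ring.
by rewrite mpolyCN; ring.
Qed.

Theorem theorem3p6 (R : realType) (n m : nat) (P : vector_field R n.+1)
  (hn : (2 <= n)%N)
  (hdeg : vf_degree P = m)
  (hsphere : vf_on_sphere P)
  (hinv : invariant_set P (last_great_sphere R n)) :
  (m = 1%N -> P ord_max = 0) /\
  (m = 2%N ->
   exists (alpha : R) (c : 'I_n.+1 -> 'I_n -> R) (A : 'I_n -> {mpoly R[n.+1]}),
     [/\ forall j : 'I_n, A j = \sum_(i < n.+1) c i j *: 'X_i,
         (\matrix_(i < n, j < n) c (fst_coord i) j)^T =
           - (\matrix_(i < n, j < n) c (fst_coord i) j) &
         P ord_max =
           (1 - \sum_(k < n.+1) 'X_k ^+ 2) * alpha%:MP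
           + \sum_(j < n) A j * 'X_(fst_coord j)]).
Proof.
have deg_last : (mmeasure mdeg (P ord_max) <= m.+1)%N.
  have : ((mmeasure mdeg (P ord_max)).-1 <= m)%N.
    by rewrite -hdeg; exact: (leq_bigmax ord_max).
  by case: (mmeasure _ _).
have equator0 x : last_great_sphere R n x -> (P ord_max).@[x 0] = 0.
  by apply: (invariant_tangent _ _ ord_max x hinv) => y [].
have axis0 i s : s ^+ 2 = 1 -> (P ord_max).@[two_coord_point i i s 0 0] = 0.
  move=> s1; have Sx := unit_sphere_axis i s s1.
  have [imax|imax] := eqVneq i ord_max; last first.
    apply: equator0; split=> //=.
    by rewrite two_coord_pointE eq_sym (negPf imax) addr0.
  have := sphere_orthogonal _ _ hsphere Sx.
  rewrite sum_two_coord_point mulr0 addr0 -imax => /eqP.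
  rewrite mulf_eq0 => /orP[/eqP//|/eqP s0].
  by move: s1; rewrite s0 expr0n => /esym/eqP; rewrite oner_eq0.
split=> m_eq; rewrite m_eq in deg_last.
  exact: affine_vanishing_axes.
have [a [e defP]] := quadratic_vanishing_equator_poles _ deg_last axis0 equator0.
exists a, (fun i j => if i == ord_max then e j else 0),
  (fun j => e j *: 'X_ord_max).
split=> //.
- move=> j; rewrite (bigD1 ord_max)//= eqxx big1 ?addr0//.
  by move=> i /negPf ->; rewrite scale0r.
- set C := \matrix_(i < n, j < n) _; suff -> : C = 0 by rewrite trmx0 oppr0.
  by apply/matrixP=> i j; rewrite !mxE -val_eqE/= ltn_eqF.
Qed.
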